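(* Let $(X,\mathcal{LSS})$ be a large scale space. Then $(X,\mathcal{LSS})$ has bounded scale measure if and only if there exists a uniformly bounded scale $\mathcal{U}\in\mathcal{LSS}$ such that for every uniformly bounded scale $\mathcal{V}\in\mathcal{LSS}$ there exists a natural number $n(\mathcal{V})$ such that for every $V\in\mathcal{V}$ there is a $\mathcal{U}$-net of $V$ which has at most $n(\mathcal{V})$ elements.
   Context: For a family $\mathcal{U}$ of subsets of a set $X$ and $V\subseteq X$, the star is $\mathrm{st}(V,\mathcal{U})=\bigcup\{U\in\mathcal{U}: U\cap V\neq\varnothing\}$; for a family $\mathcal{V}$ of subsets, $\mathrm{st}(\mathcal{V},\mathcal{U})=\{\mathrm{st}(V,\mathcal{U}): V\in\mathcal{V}\}$. A large scale structure on $X$ is a non-empty set $\mathcal{LSS}$ of families of subsets of $X$ such that: (1) if $\mathcal{V}\in\mathcal{LSS}$ and $\mathcal{U}$ is a family of subsets of $X$ such that each element of $\mathcal{U}$ consisting of more than one point is contained in some element of $\mathcal{V}$, then $\mathcal{U}\in\mathcal{LSS}$; (2) if $\mathcal{U},\mathcal{V}\in\mathcal{LSS}$, then $\mathrm{st}(\mathcal{U},\mathcal{V})\in\mathcal{LSS}$. The pair $(X,\mathcal{LSS})$ is a large scale space. Elements of $\mathcal{LSS}$ are called uniformly bounded families. A scale of $X$ is a family of subsets of $X$ that covers $X$; a uniformly bounded scale is a scale of $X$ belonging to $\mathcal{LSS}$. Given a scale $\mathcal{U}$ of $X$ and $A\subseteq X$, a $\mathcal{U}$-net in (or of) $A$ is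 a subset $B\subseteq A$ that is maximal (with respect to inclusion) among subsets of $A$ having the property that no two distinct elements of $B$ belong to the same element of $\mathcal{U}$. $(X,\mathcal{LSS})$ has bounded scale measure at scale $\mathcal{U}$, where $\mathcal{U}\in\mathcal{LSS}$ is a uniformly bounded scale, if for every uniformly bounded scale $\mathcal{V}\in\mathcal{LSS}$ there exists a natural number $u(\mathcal{V})$ such that for all $V\in\mathcal{V}$, every $\mathcal{U}$-net of $V$ has at most $u(\mathcal{V})$ elements. $(X,\mathcal{LSS})$ has bounded scale measure if it has bounded scale measure at some uniformly bounded scale $\mathcal{U}\in\mathcal{LSS}$. *)

(* Defs.v *)
From mathcomp Require Import all_boot.
From mathcomp Require Import boolp classical_sets functions cardinality.

Set Implicit Arguments.
Unset Strict Implicit.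
Unset Printing Implicit Defensive.

Local Open Scope classical_set_scope.
Local Open Scope card_scope.

(* Doubled letters (UU, VV) stand for families of subsets of X. *)

Definition star (X : Type) (V : set X) (UU : set (set X)) : set X :=
  \bigcup_(U in [set U | UU U /\ U `&` V !=set0]) U.

Definition star_family (X : Type) (VV UU : set (set X)) : set (set X) :=
  [set star V UU | V in VV].

Definition more_than_one_point (X : Type) (A : set X) : Prop :=
  exists x y, [/\ A x, A y & x <> y].

Record large_scale_structure (X : Type) (LSS : set (set (set X))) : Prop := {
  lss_nonempty : LSS !=set0;
  lss_refinement : forall VV UU : set (set X), LSS VV ->
    (forall U, UU U -> more_than_one_point U ->
       exists V, VV V /\ U `<=` V) ->
    LSS UU;
  lss_star : forall UU VV : set (set X), LSS UU -> LSS VV ->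
    LSS (star_family UU VV)
}.

Definition scale (X : Type) (UU : set (set X)) : Prop :=
  \bigcup_(U in UU) U = [set: X].

Definition uniformly_bounded_scale (X : Type) (LSS : set (set (set X)))
    (UU : set (set X)) : Prop :=
  scale UU /\ LSS UU.

Definition separated (X : Type) (UU : set (set X)) (B : set X) : Prop :=
  forall x y, B x -> B y -> x <> y -> ~ exists U, [/\ UU U, U x & U y].

Definition net (X : Type) (UU : set (set X)) (A B : set X) : Prop :=
  [/\ B `<=` A, separated UU B &
      forall C : set X, C `<=` A -> separated UU C -> B `<=` C -> C = B].

Definition at_most (X : Type) (B : set X) (n : nat) : Prop := B #<= `I_n.

Definition bounded_scale_measure_at (X : Type) (LSS : set (set (set X)))
    (UU : set (set X)) : Prop :=
  forall VV, uniformly_bounded_scale LSS VV ->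
    exists n : nat, forall V, VV V -> forall B, net UU V B -> at_most B n.

Definition bounded_scale_measure (X : Type) (LSS : set (set (set X))) : Prop :=
  exists UU, uniformly_bounded_scale LSS UU /\ bounded_scale_measure_at LSS UU.

(* Main.v *)
Require Import Defs.
From mathcomp Require Import all_boot.
From mathcomp Require Import boolp classical_sets functions cardinality.

(** Every set has a [UU]-net by Zorn's lemma, so a bound on all nets yields a
    small net in each set ([exists_net]); this gives the forward implication
    with the same scale.

    For the converse the scale [UU] has to be coarsened: a set with one small
    [UU]-net may well have large ones, for instance the leaves of a star-shaped
    set whose centre shares an element of [UU] with each leaf.  But every point
    of [V] shares an element of [UU] with some point of a given [UU]-net [A] of
    [V] ([net_dominates]), and two points of [V] attached in this way to the
    same point of [A] lie in one element of [st(UU, UU)]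
    ([star_family_meets]).  Hence a subset of [V] separated at the scale
    [st(UU, UU)] injects into [A] ([separated_star_card_le]), and the bounds for
    one net at scale [UU] bound all nets at scale [st(UU, UU)]. *)

Local Open Scope classical_set_scope.
Local Open Scope card_scope.

(** Being separated is a condition on pairs of points, and two points of the
    union of a chain already lie in one member of it; this makes Zorn's lemma
    applicable to the separated subsets of [A]. *)
Lemma exists_net {X : Type} (UU : set (set X)) (A : set X) :
  exists B, net UU A B.
Proof.
have [|B [[BA sepB] maxB]] :=
    @Zorn_bigcup X [set B | B `<=` A /\ separated UU B].
  move=> F FP totF; split=> [x [B FB Bx]|x y [B FB Bx] [C FC Cy]].
    by have [+ _] := FP _ FB; apply.
  have [sBC|sCB] := totF _ _ FB FC.
    by have [_] := FP _ FC; apply=> //; exact: sBC.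
  by have [_] := FP _ FB; apply=> //; exact: sCB.
exists B; split=> // C CA sepC BC; apply: contrapT => neqCB.
apply: (maxB C) => //; split=> // CB.
by apply: neqCB; apply/seteqP; split.
Qed.

(** If [x] shared no element of [UU] with any point of the net [A], then
    [A `|` [set x]] would be a larger separated set.  A point of [A] itself
    shares an element with itself because [UU] is a cover. *)
Lemma net_dominates {X : Type} {UU : set (set X)} {V A : set X} {x : X} :
    scale UU -> net UU V A -> V x ->
  exists2 a, A a & exists U, [/\ UU U, U x & U a].
Proof.
move=> coverUU [AV sepA maxA] Vx; apply: contrapT => far.
have farx a : A a -> ~ exists U, [/\ UU U, U x & U a].
  by move=> Aa near; apply: far; exists a.
have Ax : A x.
  rewrite -(maxA (A `|` [set x])); first by right.
  - by move=> y [/AV//|->].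
  - move=> y z [Ay|->] [Az|->] neq //; first exact: sepA.
    + by move=> [U [UUU Uy Ux]]; apply: (farx _ Ay); exists U.
    + exact: farx.
  - by move=> y Ay; left.
have [U UUU Ux] : (\bigcup_(U in UU) U) x by rewrite coverUU.
by apply: (farx _ Ax); exists U.
Qed.

Lemma star_family_meets {X : Type} {UU : set (set X)} {U W : set X}
    {x y a : X} : UU U -> UU W -> U x -> U a -> W y -> W a ->
  exists S, [/\ star_family UU UU S, S x & S y].
Proof.
move=> UUU UUW Ux Ua Wy Wa; exists (star U UU); split; first by exists U.
- by exists U => //; split=> //; exists x.
- by exists W => //; split=> //; exists a.
Qed.

Lemma scale_star_family {X : Type} {UU : set (set X)} :
  scale UU -> scale (star_family UU UU).
Proof.
move=> coverUU; apply/seteqP; split=> // x _.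
have [U UUU Ux] : (\bigcup_(U in UU) U) x by rewrite coverUU.
have [S [SS Sx _]] := star_family_meets UUU UUU Ux Ux Ux Ux.
by exists S.
Qed.

(** Attaching to each point of [B] a point of the net [A] with which it shares
    an element of [UU] is injective: points with the same image share an
    element of [star_family UU UU]. *)
Lemma separated_star_card_le {X : Type} {UU : set (set X)} {V A B : set X} :
    scale UU -> net UU V A -> B `<=` V -> separated (star_family UU UU) B ->
  B #<= A.
Proof.
move=> coverUU netA BV sepB.
have /choice[f fP] : forall x, exists a,
    B x -> A a /\ exists U, [/\ UU U, U x & U a].
  move=> x; have [Bx|nBx] := pselect (B x); last by exists x.
  by have [a Aa near] := net_dominates coverUU netA (BV _ Bx); exists a.
have injf : {in B &, injective f}.
  move=> x y /set_mem Bx /set_mem By fxy.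
  have [_ [U [UUU Ux Ufx]]] := fP _ Bx.
  have [_ [W [UUW Wy Wfy]]] := fP _ By.
  rewrite -fxy in Wfy; apply: contrapT => neq; apply: (sepB x y) => //.
  exact: (star_family_meets UUU UUW Ux Ufx Wy Wfy).
rewrite -(card_le_eql (inj_card_eq injf)); apply: subset_card_le.
by move=> _ [x Bx <-]; have [] := fP _ Bx.
Qed.

Theorem theorem2p1 (X : Type) (LSS : set (set (set X)))
    (hLSS : large_scale_structure LSS) :
  bounded_scale_measure LSS <->
  exists UU : set (set X), uniformly_bounded_scale LSS UU /\
    forall VV : set (set X), uniformly_bounded_scale LSS VV ->
      exists n : nat, forall V : set X, VV V ->
        exists B : set X, net UU V B /\ at_most B n.
Proof.
split=> [[UU [ubUU bounded]]|[UU [[coverUU LUU] small]]].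
- exists UU; split=> // VV /bounded[n boundn]; exists n => V VVV.
  by have [B netB] := exists_net UU V; exists B; split=> //; exact: boundn netB.
- exists (star_family UU UU); split.
    by split; [exact: scale_star_family coverUU|exact: (lss_star hLSS)].
  move=> VV /small[n smalln]; exists n => V /smalln[A [netA An]] B [BV sepB _].
  exact: card_le_trans (separated_star_card_le coverUU netA BV sepB) An.
Qed.
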